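(* Let $P$ be a Markov kernel on $\mathbb R^d$ (with the Euclidean distance) such that: (i) there exists $C\ge 0$ such that $\mathcal H(\delta_xP\,|\,\delta_yP)\le C|x-y|^2$ for all $x,y\in\mathbb R^d$; (ii) there exist constants $K\in[0,1]$ and $M\ge 0$ such that $W_2(\delta_xP,\delta_yP)\le K|x-y|+M$ for all $x,y\in\mathbb R^d$. Let $\mu,\nu\in\mathcal P_2(\mathbb R^d)$ and let $N\ge 1$ be an integer. If $K=1$, then $$\mathcal H(\mu P^N\,|\,\nu P^N)\le C\cdot\begin{cases}\dfrac{\left(W_2(\mu,\nu)+(N-1)M\right)^2}{N} & \text{if } W_2(\mu,\nu)\ge M,\\[2mm] W_2(\mu,\nu)^2+(N-1)M^2 & \text{if } W_2(\mu,\nu)<M,\end{cases}$$ and the right-hand side is at most $2C\,\dfrac{\left(W_2(\mu,\nu)+(N-1)M\right)^2}{N}$. If $0\le K<1$ and $N\ge 2$, then $$\mathcal H(\mu P^N\,|\,\nu P^N)\le C\cdot\begin{cases}\dfrac{1-K^2}{1-K^{2N}}\left(K^{N-1}W_2(\mu,\nu)+M\dfrac{1-K^{N-1}}{1-K}\right)^2 & \text{if } W_2(\mu,\nu)\ge M\dfrac{K^{N-1}(1+K)}{1+K^{N-1}},\\[3mm] W_2^2(\mu,\nu)+M^2\,\dfrac{(1-K^{N-1})^2(1-K^2)}{(1-K^{2N-2})(1-K)^2} & \text{if } W_2(\mu,\nu)<M\dfrac{K^{N-1}(1+K)}{1+K^{N-1}},\end{cases}$$ and the right-hand side is at most $2C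\,\dfrac{1-K^2}{1-K^{2N}}\left(K^{N-1}W_2(\mu,\nu)+M\dfrac{1-K^{N-1}}{1-K}\right)^2$.
   Context: $\mathcal P_2(\mathbb R^d)$ is the set of Borel probability measures on $\mathbb R^d$ with finite second moment. $W_2(\mu,\nu)=\inf_{\gamma\in\Gamma(\mu,\nu)}\left(\int|x-y|^2\,d\gamma(x,y)\right)^{1/2}$, where $\Gamma(\mu,\nu)$ is the set of couplings of $\mu$ and $\nu$. The relative entropy is $\mathcal H(\mu\,|\,\pi)=\int\log\left(\frac{d\mu}{d\pi}\right)d\mu$ if $\mu\ll\pi$, and $+\infty$ otherwise. For a Markov kernel $P$, $\delta_xP$ is the transition measure from $x$, $\mu P=\int\delta_xP\,d\mu(x)$, and $P^N$ is the $N$-fold composition. *)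

(* Defs.v *)
From HB Require Import structures.
From mathcomp Require Import all_boot all_order all_algebra.
From mathcomp Require Import all_classical all_reals all_analysis.
From mathcomp Require Import measurable_realfun ring.

Set Implicit Arguments.
Unset Strict Implicit.
Unset Printing Implicit Defensive.
Import Order.TTheory GRing.Theory Num.Theory.
Import numFieldNormedType.Exports.

Local Open Scope classical_set_scope.
Local Open Scope ring_scope.
Local Open Scope ereal_scope.
Local Open Scope charge_scope.

(* R^d, whose measurable sets are the Borel sets: the matrix topology on
   'rV[R]_d (induced by the sup norm) is the Euclidean topology. *)
Notation borelR R d := (g_sigma_algebraType (@open 'rV[R]_d)).

(* The norm that the library puts on 'rV[R]_d is the sup norm, hence the
   explicit Euclidean norm and distance. *)
Definition eucl_norm (R : realType) (d : nat) (x : 'rV[R]_d) : R :=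
  Num.sqrt (\sum_(i < d) x ord0 i ^+ 2)%R.

Definition eucl_dist (R : realType) (d : nat) (x y : 'rV[R]_d) : R :=
  eucl_norm (x - y)%R.

Definition finite_second_moment (R : realType) (d : nat)
    (mu : probability (borelR R d) R) : Prop :=
  \int[mu]_x (eucl_norm x ^+ 2)%:E < +oo.

Definition coupling dX dY (X : measurableType dX) (Y : measurableType dY)
    (R : realType) (mu : probability X R) (nu : probability Y R) :
    set (probability (X * Y)%type R) :=
  [set g | (forall A, measurable A -> pushforward g fst A = mu A) /\
           (forall B, measurable B -> pushforward g snd B = nu B)].

(* Defined for all probability measures, with values in [0, +oo]. *)
Definition W2 (R : realType) (d : nat) (mu nu : probability (borelR R d) R) :
    \bar R :=
  ereal_inf [set sqrte (\int[g]_z (eucl_dist z.1 z.2 ^+ 2)%:E) |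
             g in coupling mu nu].

Lemma eucl_norm_sqr (R : realType) d (x : 'rV[R]_d) :
  (eucl_norm x ^+ 2 = \sum_(i < d) x ord0 i ^+ 2)%R.
Proof. by rewrite /eucl_norm sqr_sqrtr// sumr_ge0// => i _; exact: sqr_ge0. Qed.

Lemma measurable_coord (R : realType) d (i : 'I_d) :
  measurable_fun setT ((fun x => x ord0 i) : borelR R d -> R).
Proof.
apply: (measurability _ (measurable_realfun.RGenOInfty.measurableE R)) => _ [_ [a ->] <-].
rewrite setTI; apply: sub_sigma_algebra.
apply: open_comp; last exact: interval_open.
by move=> x _; exact: coord_continuous.
Qed.

Lemma measurable_eucl_norm_sqr (R : realType) d :
  measurable_fun setT ((fun x => eucl_norm x ^+ 2)%R : borelR R d -> R).
Proof.
under eq_fun do rewrite eucl_norm_sqr.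
apply: measurable_sum => i; apply: measurable_funX; exact: measurable_coord.
Qed.

Lemma eucl_dist_sqr_le (R : realType) d (x y : 'rV[R]_d) :
  (eucl_dist x y ^+ 2 <= 2 * eucl_norm x ^+ 2 + 2 * eucl_norm y ^+ 2)%R.
Proof.
rewrite /eucl_dist !eucl_norm_sqr !mulr_sumr -big_split; apply: ler_sum => i _ /=.
rewrite !mxE -subr_ge0.
rewrite [leRHS](_ : _ = (x ord0 i + y ord0 i) ^+ 2)%R ?sqr_ge0//; ring.
Qed.

Lemma W2_fin_num (R : realType) d (mu nu : probability (borelR R d) R) :
  finite_second_moment mu -> finite_second_moment nu ->
  W2 mu nu \is a fin_num.
Proof.
move=> mu2 nu2.
have ge0 : 0 <= W2 mu nu.
  by apply/ereal_infP => _ [g _ <-]; exact: sqrte_ge0.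
rewrite ge0_fin_numE//; apply/ereal_inf_ltP.
pose g : probability _ R := (mu \x nu)%E.
have g1 A : measurable A -> pushforward g fst A = mu A.
  move=> mA; rewrite /pushforward -setXT [LHS]product_measure1E//.
  by rewrite [X in _ * X]probability_setT mule1.
have g2 A : measurable A -> pushforward g snd A = nu A.
  move=> mA; rewrite /pushforward -setTX [LHS]product_measure1E//.
  by rewrite [X in X * _]probability_setT mul1e.
exists (sqrte (\int[g]_z (eucl_dist z.1 z.2 ^+ 2)%:E)); first by exists g.
have mE : measurable_fun [set: borelR R d] (fun x : borelR R d => (eucl_norm x ^+ 2)%:E).
  by apply/measurable_EFinP; exact: measurable_eucl_norm_sqr.
have I1 : \int[g]_z (eucl_norm z.1 ^+ 2)%:E = \int[mu]_x (eucl_norm x ^+ 2)%:E.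
  rewrite -(@eq_measure_integral _ _ _ _ mu (pushforward g fst)); last first.
    by move=> A mA _; exact: g1.
  rewrite (ge0_integral_pushforward measurable_fst)//.
  by move=> x _; rewrite lee_fin sqr_ge0.
have I2 : \int[g]_z (eucl_norm z.2 ^+ 2)%:E = \int[nu]_x (eucl_norm x ^+ 2)%:E.
  rewrite -(@eq_measure_integral _ _ _ _ nu (pushforward g snd)); last first.
    by move=> A mA _; exact: g2.
  rewrite (ge0_integral_pushforward measurable_snd)//.
  by move=> x _; rewrite lee_fin sqr_ge0.
suff : \int[g]_z (eucl_dist z.1 z.2 ^+ 2)%:E < +oo.
  by case: (\int[g]_z _) => [r|//|] _ //=; rewrite ltey.
have m1 : measurable_fun setT (fun z : borelR R d * borelR R d => (eucl_norm z.1 ^+ 2)%R).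
  by apply: measurableT_comp (@measurable_eucl_norm_sqr R d) _; exact: measurable_fst.
have m2 : measurable_fun setT (fun z : borelR R d * borelR R d => (eucl_norm z.2 ^+ 2)%R).
  by apply: measurableT_comp (@measurable_eucl_norm_sqr R d) _; exact: measurable_snd.
apply: (@le_lt_trans _ _ (\int[g]_z (2 * eucl_norm z.1 ^+ 2 + 2 * eucl_norm z.2 ^+ 2)%:E)).
  apply: ge0_le_integral => //.
  - by move=> z _; rewrite lee_fin sqr_ge0.
  - apply/measurable_EFinP; rewrite /eucl_dist; under eq_fun do rewrite eucl_norm_sqr.
    apply: measurable_sum => i; apply: measurable_funX.
    under eq_fun do rewrite !mxE.
    apply: measurable_funB.
      by apply: measurableT_comp (measurable_coord i) _; exact: measurable_fst.
    by apply: measurableT_comp (measurable_coord i) _; exact: measurable_snd.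

  - by apply/measurable_EFinP/measurable_funD; apply: measurable_funM.
  - by move=> z _; rewrite lee_fin eucl_dist_sqr_le.
under eq_integral => z _ do
  rewrite EFinD [X in X + _]EFinM [X in _ + X]EFinM.
have J (f : borelR R d * borelR R d -> R) : (forall z, 0 <= f z)%R ->
    measurable_fun setT f ->
    \int[g]_z (2%:E * (f z)%:E) = 2%:E * \int[g]_z (f z)%:E.
  move=> f0 mf; rewrite ge0_integralZl_EFin//; last exact/measurable_EFinP.
  by move=> z _; rewrite lee_fin.
rewrite ge0_integralD//.
- rewrite (J (fun z => eucl_norm z.1 ^+ 2)%R)//; last by move=> z; exact: sqr_ge0.
  rewrite (J (fun z => eucl_norm z.2 ^+ 2)%R)//; last by move=> z; exact: sqr_ge0.
  by rewrite I1 I2 lte_add_pinfty// lte_mul_pinfty.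
- by move=> z _; rewrite -EFinM lee_fin mulr_ge0// sqr_ge0.
- by apply/measurable_EFinP; apply: measurable_funM.
- by move=> z _; rewrite -EFinM lee_fin mulr_ge0// sqr_ge0.
- by apply/measurable_EFinP; apply: measurable_funM.
Qed.

(* `lne` is the logarithm extended by lne 0 = -oo. *)
Definition rel_entropy dT (T : measurableType dT) (R : realType)
    (mu pi : probability T R) : \bar R :=
  if `[< mu `<< pi >]
  then \int[mu]_x lne (('d (charge_of_finite_measure mu) '/d pi) x)
  else +oo.

(* k x, seen as an element of `probability Y R`. *)
Section transition.
Context dX dY (X : measurableType dX) (Y : measurableType dY) (R : realType).
Variables (k : R.-pker X ~> Y) (x : X).

Definition transition : set Y -> \bar R := k x.

HB.instance Definition _ := Measure.on transition.
HB.instance Definition _ :=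
  Measure_isProbability.Build _ _ _ transition (prob_kernel x).

End transition.

Section kernel_act.
Context dX dY (X : measurableType dX) (Y : measurableType dY) (R : realType).
Variables (mu : probability X R) (k : R.-pker X ~> Y).

Definition kernel_act (A : set Y) : \bar R := \int[mu]_x k x A.

Let kernel_act0 : kernel_act set0 = 0.
Proof. by apply: integral0_eq => x _; rewrite measure0. Qed.

Let kernel_act_ge0 A : 0 <= kernel_act A.
Proof. by apply: integral_ge0 => x _; exact: measure_ge0. Qed.

Let kernel_act_sigma_additive : semi_sigma_additive kernel_act.
Proof.
move=> F mF tF mUF; rewrite [X in _ --> X](_ : _ =
    \int[mu]_x (\sum_(n <oo) k x (F n))); last first.
  apply: eq_integral => x _.
  by apply/esym/cvg_lim => //; exact/measure_semi_sigma_additive.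
apply/cvg_closeP; split.
  by apply: is_cvg_nneseries => n _ _; exact: integral_ge0.
by rewrite closeE// integral_nneseries// => n; exact: measurable_kernel.
Qed.

HB.instance Definition _ :=
  isMeasure.Build _ _ _ kernel_act kernel_act0 kernel_act_ge0 kernel_act_sigma_additive.

Let kernel_act_setT : kernel_act setT = 1.
Proof.
rewrite /kernel_act (eq_integral (cst 1)); first last.
  by move=> x _; rewrite prob_kernel.
by rewrite integral_cst// mul1e; exact: probability_setT.
Qed.

HB.instance Definition _ := Measure_isProbability.Build _ _ _ kernel_act kernel_act_setT.

End kernel_act.

Section kernel_comp.
Context dX dY dZ (X : measurableType dX) (Y : measurableType dY)
  (Z : measurableType dZ) (R : realType).
Variables (k : R.-pker X ~> Y) (l : R.-pker Y ~> Z).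

Definition kernel_comp : X -> {measure set Z -> \bar R} := mkcomp_noparam k l.

HB.instance Definition _ := Kernel.on kernel_comp.

Let kernel_comp_setT x : kernel_comp x setT = 1.
Proof.
rewrite /kernel_comp /mkcomp_noparam /= /kcomp_noparam.
rewrite (eq_integral (cst 1)); first last.
  by move=> y _; rewrite prob_kernel.
by rewrite integral_cst// mul1e; exact: prob_kernel.
Qed.

HB.instance Definition _ :=
  Kernel_isProbability.Build _ _ _ _ _ kernel_comp kernel_comp_setT.

End kernel_comp.

Fixpoint kernel_iter dX (X : measurableType dX) (R : realType)
    (k : R.-pker X ~> X) (n : nat) : R.-pker X ~> X :=
  if n is n'.+1 then kernel_comp (kernel_iter k n') k
  else kdirac (@measurable_id _ X setT).

(* Main.v *)
Require Import Defs.
From HB Require Import structures.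
From mathcomp Require Import all_boot all_order all_algebra.
From mathcomp Require Import all_classical all_reals all_analysis.
From mathcomp Require Import measurable_realfun ring lra.

Set Implicit Arguments.
Unset Strict Implicit.
Unset Printing Implicit Defensive.
Import Order.TTheory GRing.Theory Num.Theory.
Import numFieldNormedType.Exports.

Local Open Scope classical_set_scope.
Local Open Scope ring_scope.

(** The entropy between the laws after [N] steps is bounded by steering, one
    step at a time, a copy of the chain started at [y] towards the chain
    started at [x].  If the two current positions are at distance [r], the
    steered copy may pretend to sit at [z = y + eta (x - y)]: this costs at
    most [C (eta r)^2] of entropy by the first assumption, and the next
    distance is controlled by [K (1 - eta) r + M] by the second one.  At the
    last step [eta = 1], so that both chains have the same law.  The total
    price of a schedule of coefficients [eta] is [C * shift_cost].

    Instead of building the steered process on path space, which would require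
    measurable choices of optimal couplings, the proof runs on the dual side.
    By the Donsker-Varadhan formula ([rel_entropy_lower] and
    [rel_entropy_le_of_dual]), a bound [B] on the entropy is the same as
    [int f d(mu P^N) <= ln (int e^f d(nu P^N)) + B] for all bounded [f].  For
    Dirac initial laws the inequality
    [P^N f (x) <= ln (P^N e^f (y)) + C * shift_cost s |x - y|]
    is proved by induction on [N] ([iter_markov_op_dual]).  With
    [G = ln (P^N e^f)], one compares [int P^N f d(delta_x P)] with
    [int G d(delta_z P)] through couplings, and then [int G d(delta_z P)] with
    [ln (int e^G d(delta_y P)) = ln (P^(N+1) e^f (y))] through the entropy
    assumption.  Both comparisons are made at a fixed pair of points, so that
    nothing has to be selected measurably.  The comparison through couplings
    works because [shift_cost] is [p r^2 + q r + e] with nonnegative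
    coefficients, hence a concave function of [r^2]
    ([le_Rintegral_W2]).

    It remains to choose the schedule.  Writing [a_n = eta_n D_n] for the
    displacements, where [D_0 = w] and [D_(n+1) = K (D_n - a_n) + M], the
    constraint of reaching the other chain at step [N] reads
    [sum_n K^(N-1-n) a_n = K^(N-1) w + M (1 + K + ... + K^(N-2))], and
    [sum_n a_n^2] is minimal when [a_n] is proportional to [K^(N-1-n)]
    ([optimal_schedule]).  This requires [a_0 <= w]; when that fails, the best
    is to spend [a_0 = w] at once and to be optimal from distance [M] on
    ([schedule_steered_bound]). *)

(** * Bounded test functions *)

(** Test functions take values in [0, b] rather than in [-b, b]: adding a
    constant to the test function shifts both sides of the dual inequality
    equally, and nonnegativity
    makes integration against kernels and mixtures unconditional. *)
Definition bounded_test dT (T : measurableType dT) (R : realType) (b : R)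
    (f : T -> R) : Prop :=
  measurable_fun setT f /\ forall x, 0 <= f x <= b.

Section bounded_test_functions.
Context dT (T : measurableType dT) (R : realType) (a : probability T R).

Lemma probability_setT_lty : (a setT < +oo)%E.
Proof. by rewrite probability_setT ltry. Qed.

Lemma integral_cst1 (c : \bar R) : (\int[a]_x c = c)%E.
Proof. by rewrite integral_cst// [X in (_ * X)%E]probability_setT mule1. Qed.

Lemma bounded_test_integrable b (f : T -> R) :
  bounded_test b f -> a.-integrable setT (EFin \o f).
Proof.
move=> [mf fb]; apply: measurable_bounded_integrable => //.
  exact: probability_setT_lty.
exists b; split; first by rewrite num_real.
move=> c bc x _ /=; have /andP[f0 fle] := fb x.
by rewrite ger0_norm// (le_trans fle)// ltW.
Qed.

Lemma EFin_Rintegral b (f : T -> R) : bounded_test b f ->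
  (\int[a]_x f x)%:E = (\int[a]_x (f x)%:E)%E.
Proof.
move=> bf; rewrite fineK//; apply: integrable_fin_num => //.
exact: bounded_test_integrable bf.
Qed.

Lemma Rintegral_cst1 (c : R) : \int[a]_x c = c.
Proof. by rewrite /Rintegral integral_cst1. Qed.

Lemma bounded_test_cst (c : R) : 0 <= c -> bounded_test c (fun=> c : R) (T := T).
Proof. by move=> c0; split=> // x; rewrite c0 lexx. Qed.

Lemma Rintegral_bounded b (f : T -> R) : bounded_test b f ->
  0 <= \int[a]_x f x <= b.
Proof.
move=> bf; have fb := bf.2.
rewrite Rintegral_ge0//=; last by move=> x _; case/andP: (fb x).
have [b0|b0] := leP 0 b.
  rewrite -[leRHS]Rintegral_cst1; apply: le_Rintegral => //.
  - exact: bounded_test_integrable bf.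
  - exact: bounded_test_integrable (bounded_test_cst b0).
  - by move=> x _; case/andP: (fb x).
rewrite (_ : f = fun=> b); first by rewrite Rintegral_cst1.
by apply/funext => x; have := fb x; lra.
Qed.

Lemma bounded_test_expR b (f : T -> R) :
  bounded_test b f -> bounded_test (expR b) (expR \o f).
Proof.
move=> [mf fb]; split; first exact: measurableT_comp.
by move=> x /=; rewrite expR_ge0 ler_expR; case/andP: (fb x).
Qed.

Lemma Rintegral_expR_ge1 b (f : T -> R) : bounded_test b f ->
  1 <= \int[a]_x expR (f x).
Proof.
move=> bf; rewrite -[leLHS]Rintegral_cst1; apply: le_Rintegral => //.
- exact: bounded_test_integrable (bounded_test_cst ler01).
- exact: bounded_test_integrable (bounded_test_expR bf).
- by move=> x _; rewrite -[leLHS]expR0 ler_expR; case/andP: (bf.2 x).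
Qed.

(** The integral is a difference of two nonnegative integrals, the first
    increasing and the second decreasing in the integrand, and subtraction in
    [\bar R] is monotone; so the comparison holds also for integrals of infinite
    or undefined value, such as that of a logarithmic density. *)
Lemma le_integral_measurable (f g : T -> \bar R) :
  measurable_fun setT f -> measurable_fun setT g ->
  (forall x, f x <= g x)%E -> (\int[a]_x f x <= \int[a]_x g x)%E.
Proof.
move=> mf mg fg; rewrite integralE [leRHS]integralE leeB//.
- apply: ge0_le_integral => //.
  + exact: measurable_funepos.
  + exact: measurable_funepos.
  + by move=> x _; apply: funepos_le => //; rewrite inE.
- apply: ge0_le_integral => //.
  + exact: measurable_funeneg.
  + exact: measurable_funeneg.
  + by move=> x _; apply: funeneg_le => //; rewrite inE.
Qed.

(** Jensen's inequality for the exponential, obtained by integrating the tangent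
    inequality [1 + t <= exp t] at [t = g x - ln Z]. *)
Lemma Rintegral_ln_le b (g : T -> R) :
  bounded_test b g -> \int[a]_x g x <= ln (\int[a]_x expR (g x)).
Proof.
move=> bg; set Z := \int[a]_x expR (g x).
have Z1 : 1 <= Z by exact: Rintegral_expR_ge1 bg.
have Z0 : 0 < Z by exact: lt_le_trans Z1.
have bZ : bounded_test (ln Z) (fun=> ln Z : R) (T := T).
  by apply: bounded_test_cst; rewrite ln_ge0.
have ieg := bounded_test_integrable (bounded_test_expR bg).
have ig := bounded_test_integrable bg.
have iZ := bounded_test_integrable bZ.
have i1 := bounded_test_integrable (bounded_test_cst (@ler01 R)).
have ieZ : a.-integrable setT (EFin \o (fun x => Z^-1 * expR (g x))).
  exact: (integrableZl measurableT Z^-1 ieg).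
have : \int[a]_x (g x + 1) <= \int[a]_x (Z^-1 * expR (g x) + ln Z).
  apply: le_Rintegral => //.
  - exact: integrableD ig i1.
  - exact: integrableD ieZ iZ.
  - move=> x _; have := expR_ge1Dx (g x - ln Z).
    by rewrite expRB lnK// mulrC; lra.
rewrite !RintegralD// RintegralZl// mulVf ?gt_eqF// !Rintegral_cst1.
by lra.
Qed.

End bounded_test_functions.

(** * The Donsker-Varadhan duality *)
Section donsker_varadhan.
Context dT (T : measurableType dT) (R : realType) (a b : probability T R).

(** A Radon-Nikodym derivative is nonnegative only almost everywhere; choosing a
    version that is finite and nonnegative everywhere makes pointwise
    inequalities on its logarithm available. *)
Lemma rel_entropy_density : a `<< b -> exists r : T -> R,
  [/\ measurable_fun setT r, (forall x, 0 <= r x),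
      (forall f : T -> \bar R, (forall x, 0 <= f x)%E -> measurable_fun setT f ->
        \int[b]_x (f x * (r x)%:E) = \int[a]_x f x)%E &
      rel_entropy a b = (\int[a]_x lne (r x)%:E)%E].
Proof.
move=> ab; pose rho := Radon_Nikodym_SigmaFinite.f a b.
have rho0 x : (0 <= rho x)%E by exact: Radon_Nikodym_SigmaFinite.f_ge0.
have rhof x : rho x \is a fin_num by exact: Radon_Nikodym_SigmaFinite.f_fin_num.
have mrho : measurable_fun setT rho.
  exact: measurable_int (Radon_Nikodym_SigmaFinite.f_integrable ab).
exists (fine \o rho); split.
- exact: measurableT_comp.
- by move=> x; rewrite /= fine_ge0.
- move=> f f0 mf; transitivity (\int[b]_x (f x * rho x))%E.
    by apply: eq_integral => x _; rewrite -[in RHS](fineK (rhof x)).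
  exact: Radon_Nikodym_SigmaFinite.change_of_variables.
have mlne (h : T -> \bar R) : (forall x, h x \is a fin_num) ->
    measurable_fun setT h -> measurable_fun setT (fun x => lne (h x)).
  move=> hf mh; rewrite (_ : (fun _ => _) = fun x =>
    if (fine (h x) <= 0)%R then -oo%E else (ln (fine (h x)))%:E).
    apply: measurable_fun_ifT => //.
      by apply: measurable_fun_ler => //; exact: measurableT_comp.
    by apply/measurable_EFinP; do 2 apply: measurableT_comp => //.
  by apply/funext => x; case: (h x) (hf x).
rewrite /rel_entropy asboolT//.
apply: ae_eq_integral => //.
- by apply: mlne => [x|//]; exact: Radon_Nikodym_fin_num.
- rewrite [X in measurable_fun _ X](_ : _ = fun x => lne (rho x)); first exact: mlne.
  by apply/funext => x; rewrite -[in RHS](fineK (rhof x)).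
apply: (null_dominates_ae_eq _ ab) => //.
have := ae_eq_sym (ae_eq_Radon_Nikodym_SigmaFinite ab measurableT).
move=> [N [mN N0 sN]]; exists N; split=> // x /= nx; apply: sN => /= h; apply: nx => _.
by rewrite (h I) -/(rho x); case: (rho x) (rhof x).
Qed.

Lemma measurable_lne_EFin (r : T -> R) : measurable_fun setT r ->
  measurable_fun setT (fun x => lne (r x)%:E).
Proof.
move=> mr; apply: measurable_fun_ifT => //.
  exact: measurable_fun_ler.
by apply/measurable_EFinP; exact: measurableT_comp.
Qed.

(** Integrating [1 + t <= exp t] at [t = g - k - ln r], where
    [k = ln (int e^g db)] and [r] is the density, gives
    [int g da - k <= int ln r da], because
    [int exp (g - k - ln r) da <= int exp (g - k) db = 1]. *)
Lemma rel_entropy_lower c (g : T -> R) : bounded_test c g ->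
  ((\int[a]_x g x - ln (\int[b]_x expR (g x)))%:E <= rel_entropy a b)%E.
Proof.
move=> bg; have [ab|ab] := pselect (a `<< b); last first.
  by rewrite /rel_entropy asboolF// leey.
have [r [mr r0 chg ->]] := rel_entropy_density ab.
have mg := bg.1.
set Z := \int[b]_x expR (g x); set k := ln Z.
have Z1 : 1 <= Z by exact: Rintegral_expR_ge1 bg.
have Z0 : 0 < Z by exact: lt_le_trans Z1.
(* where the density vanishes the lower bound must be -oo, hence the value +oo *)
pose u x := if r x <= 0 then +oo%E else (expR (g x - k - ln (r x)))%:E.
have u0 x : (0 <= u x)%E by rewrite /u; case: ifP => // _; rewrite lee_fin expR_ge0.
have mu : measurable_fun setT u.
  apply: measurable_fun_ifT => //; first exact: measurable_fun_ler.
  apply/measurable_EFinP/measurableT_comp => //.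
  apply: measurable_funB; first exact: measurable_funB.
  exact: measurableT_comp.
have bexp := bounded_test_expR bg.
have Iu : (\int[a]_x u x <= 1)%E.
  rewrite -chg//.
  have -> : 1%E = (\int[b]_x (Z^-1%:E * (expR (g x))%:E))%E.
    rewrite ge0_integralZl_EFin//.
    - by rewrite -(EFin_Rintegral b bexp) -EFinM mulVf// gt_eqF.
    - by apply/measurable_EFinP; exact: bexp.1.
    - by rewrite invr_ge0 ltW.
  apply: ge0_le_integral => //.
  - by move=> x _; rewrite mule_ge0// lee_fin.
  - by apply: emeasurable_funM => //; exact/measurable_EFinP.
  - by apply/measurable_EFinP/measurable_funM => //; exact: bexp.1.
  - move=> x _; rewrite /u; case: ifPn => [rx|].
      have -> : r x = 0 by apply/eqP; rewrite eq_le rx r0.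
      by rewrite mule0 -EFinM lee_fin mulr_ge0// ?invr_ge0 ?expR_ge0// ltW.
    rewrite -ltNge => rx; rewrite -!EFinM lee_fin.
    by rewrite -addrA -opprD expRB expRD !lnK// invfM mulrA divfK ?gt_eqF// mulrC.
have iu : a.-integrable setT u.
  apply/integrableP; split=> //; under eq_integral do rewrite gee0_abs//.
  by rewrite (le_lt_trans Iu)// ltry.
have ig := bounded_test_integrable a bg.
have ik : a.-integrable setT (EFin \o (fun=> 1 - k)).
  apply: measurable_bounded_integrable => //; first exact: probability_setT_lty.
  by exists `|1 - k|; split; [rewrite num_real|move=> z kz x _ /=; exact: ltW].
apply: (@le_trans _ _ (\int[a]_x ((EFin \o g) x + (EFin \o (fun=> 1 - k)%R) x - u x)%E)%E).
  rewrite integralB//; last by apply: integrableD.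
  rewrite integralD// -(EFin_Rintegral a bg) /= integral_cst1.
  have : (0 <= \int[a]_x u x)%E by exact: integral_ge0.
  move: Iu; case: (\int[a]_x u x)%E => [s| |]//; rewrite !lee_fin => s1 _.
  by lra.
apply: le_integral_measurable.
- apply: emeasurable_funB => //.
  by apply: emeasurable_funD => //; exact/measurable_EFinP.
- exact: measurable_lne_EFin.
move=> x; rewrite /u /=; case: ifPn => // rx.
rewrite -!EFinD lee_fin.
have := expR_ge1Dx (g x - k - ln (r x)); lra.
Qed.

(** On a [b]-null set [A], the test function [n * 1_A] yields [n * a A <= B]
    for every [n]. *)
Lemma null_dominates_of_dual (B : R) :
  (forall c (f : T -> R), bounded_test c f ->
     \int[a]_x f x <= ln (\int[b]_x expR (f x)) + B) -> a `<< b.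
Proof.
move=> dual; apply/null_content_dominatesP => A mA bA.
have key (n : R) : 0 <= n -> n * fine (a A) <= B.
  move=> n0.
  have mI : measurable_fun setT (fun x => n * \1_A x : R).
    by apply: measurable_funM => //; exact: measurable_indic.
  have bI : bounded_test n (fun x => n * \1_A x : R).
    split=> // x; rewrite indicE; case: (x \in A); rewrite ?mulr1 ?mulr0 ?lexx n0//.
  have := dual _ _ bI.
  rewrite (_ : \int[a]_x _ = n * fine (a A)); last first.
    apply/EFin_inj; rewrite (EFin_Rintegral a bI).
    under eq_integral do rewrite EFinM.
    rewrite ge0_integralZl_EFin//; last first.
      by apply/measurable_EFinP; exact: measurable_indic.
    by rewrite integral_indic// setIT EFinM fineK// fin_num_measure.
  rewrite (_ : \int[b]_x _ = 1) ?ln1 ?add0r//.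
  apply/EFin_inj; rewrite (EFin_Rintegral b (bounded_test_expR bI)) /=.
  rewrite (ae_eq_integral (cst 1%E))//.
  - by rewrite integral_cst1.
  - by apply/measurable_EFinP; exact: (bounded_test_expR bI).1.
  - exists A; split=> // x /= nx; apply: contrapT => xA; apply: nx => _.
    by rewrite indicE memNset// mulr0 expR0.
have B0 : 0 <= B by have := key _ (lexx 0); rewrite mul0r.
have aA0 : 0 <= fine (a A) by exact: fine_ge0.
apply/eqP; rewrite -(fineK (fin_num_measure a A mA)) eqe eq_le aA0 andbT leNgt.
apply/negP => aA.
have := key ((B + 1) / fine (a A)).
rewrite divfK ?gt_eqF// => /(_ _)/wrap[]; first by rewrite divr_ge0// addr_ge0.
by lra.
Qed.

(** The optimal test function is the logarithm of the density [r], which is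
    neither bounded nor bounded below.  Cutting [r] below at [e] and above at
    [exp n] makes it admissible (after adding [- ln e]) and increases
    [int r db = 1] by at most [e]; the upper cut is removed by monotone
    convergence, the lower one by letting [e] tend to [0]. *)
Lemma rel_entropy_le_of_dual (B : R) :
  (forall c (f : T -> R), bounded_test c f ->
     \int[a]_x f x <= ln (\int[b]_x expR (f x)) + B) ->
  (rel_entropy a b <= B%:E)%E.
Proof.
move=> dual.
have [r [mr r0 chg ->]] := rel_entropy_density (null_dominates_of_dual dual).
have Ir : (\int[b]_x (r x)%:E = 1)%E.
  rewrite -[RHS](integral_cst1 a) -chg//.
  by apply: eq_integral => x _; rewrite mul1e.
suff small e : 0 < e -> e <= 1 -> (\int[a]_x lne (r x)%:E <= (B + e)%:E)%E.
  apply/lee_addgt0Pr => e e0; rewrite -EFinD.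
  apply: (le_trans (small (Num.min e 1) _ _)).
  - by rewrite lt_min e0 ltr01.
  - by rewrite ge_min lexx orbT.
  - by rewrite lee_fin lerD2l ge_min lexx.
move=> e0 e1.
pose v x := Num.max e (r x).
have ve x : e <= v x by rewrite le_max lexx.
have v0 x : 0 < v x by exact: lt_le_trans (ve x).
have mv : measurable_fun setT v by exact: measurable_maxr.
pose w n x := Num.min (expR n%:R) (v x).
have we n x : e <= w n x.
  by rewrite le_min ve andbT (le_trans e1)// -[leLHS]expR0 ler_expR.
have w0 n x : 0 < w n x by exact: lt_le_trans (we n x).
have mw n : measurable_fun setT (w n) by exact: measurable_minr.
pose f n x := ln (w n x) - ln e.
have f0 n x : 0 <= f n x by rewrite subr_ge0 ler_ln ?posrE.
have bf n : bounded_test (n%:R - ln e) (f n).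
  split; first by apply: measurable_funB => //; exact: measurableT_comp.
  move=> x; rewrite f0 /= lerD2r -[leRHS]expRK ler_ln ?posrE ?expR_gt0//.
  by rewrite ge_min lexx.
have If n : (\int[a]_x (f n x)%:E <= (B + e - ln e)%:E)%E.
  rewrite -(EFin_Rintegral a (bf n)) lee_fin.
  apply: (le_trans (dual _ _ (bf n))).
  have Ile : \int[b]_x expR (f n x) <= (1 + e) / e.
    rewrite -lee_fin (EFin_Rintegral b (bounded_test_expR (bf n))).
    apply: (@le_trans _ _ (\int[b]_x (e^-1%:E * ((r x)%:E + e%:E)))%E).
      apply: ge0_le_integral => //.
      - by move=> x _; rewrite lee_fin expR_ge0.
      - by apply/measurable_EFinP; exact: (bounded_test_expR (bf n)).1.
      - apply/measurable_EFinP/measurable_funM => //.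
        exact: measurable_funD.
      - move=> x _; rewrite -EFinD -EFinM lee_fin /f /= expRB !lnK ?posrE// mulrC.
        rewrite ler_pM2l ?invr_gt0// ge_min ge_max.
        by rewrite lerDr r0 lerDl (ltW e0) orbT.
    rewrite ge0_integralZl_EFin//.
    - rewrite ge0_integralD//.
      + by rewrite Ir integral_cst1 -EFinD -EFinM lee_fin mulrC.
      + by move=> x _; rewrite lee_fin.
      + exact/measurable_EFinP.
      + by move=> x _; rewrite lee_fin ltW.
    - by move=> x _; rewrite -EFinD lee_fin addr_ge0// ltW.
    - by apply/measurable_EFinP; exact: measurable_funD.
    - by rewrite invr_ge0 ltW.
  have I1 := Rintegral_expR_ge1 b (bf n).
  have lnle : ln (\int[b]_x expR (f n x)) <= ln ((1 + e) / e).
    by rewrite ler_ln ?posrE ?divr_gt0 ?addr_gt0//; exact: lt_le_trans I1.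
  move: lnle; rewrite ln_div ?posrE ?addr_gt0// => lnle.
  have : ln (1 + e) <= e by apply: le_ln1Dx; lra.
  lra.
have Iv : (\int[a]_x (ln (v x) - ln e)%:E <= (B + e - ln e)%:E)%E.
  rewrite (_ : (\int[a]_x _ = limn (fun n => \int[a]_x (f n x)%:E))%E).
    apply: lime_le; last by near=> n; exact: If.
    apply: ereal_nondecreasing_is_cvgn => m n mn.
    apply: ge0_le_integral => //.
    - by move=> x _; rewrite lee_fin.
    - by apply/measurable_EFinP; exact: (bf m).1.
    - by apply/measurable_EFinP; exact: (bf n).1.
    - move=> x _; rewrite lee_fin lerD2r ler_ln ?posrE// /w.
      by rewrite le_min !ge_min lexx ler_expR ler_nat mn orbT.
  rewrite -monotone_convergence//.
  - apply: eq_integral => x _; apply/esym/cvg_lim => //.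
    apply: cvg_near_cst; near=> n.
    congr EFin; rewrite /f /w min_r//.
    rewrite -[leLHS]lnK ?posrE// ler_expR.
    near: n; exact: nbhs_infty_ger.
  - by move=> n; apply/measurable_EFinP; exact: (bf n).1.
  - by move=> n x _; rewrite lee_fin.
  - move=> x _ m n mn; rewrite lee_fin lerD2r ler_ln ?posrE// /w.
    by rewrite le_min !ge_min lexx ler_expR ler_nat mn orbT.
apply: (@le_trans _ _ (\int[a]_x ((ln (v x) - ln e)%:E + (ln e)%:E))%E).
  apply: le_integral_measurable.
  - exact: measurable_lne_EFin.
  - apply/measurable_EFinP/measurable_funD => //.
    by apply: measurable_funB => //; exact: measurableT_comp.
  - move=> x; rewrite -EFinD subrK /=; case: ifPn; first by rewrite leNye.
    by rewrite -ltNge => rx; rewrite lee_fin ler_ln ?posrE// le_max lexx orbT.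
have gv x : (0 <= (ln (v x) - ln e)%:E)%E by rewrite lee_fin subr_ge0 ler_ln ?posrE.
have mlv : measurable_fun setT (fun x => (ln (v x) - ln e)%:E).
  by apply/measurable_EFinP/measurable_funB => //; exact: measurableT_comp.
rewrite integralD//.
- rewrite integral_cst1 (_ : (B + e)%:E = (B + e - ln e)%:E + (ln e)%:E)%E.
    by rewrite leeD2r.
  by rewrite -EFinD subrK.
- apply/integrableP; split=> //; under eq_integral do rewrite gee0_abs//.
  by rewrite (le_lt_trans Iv)// ltry.
- apply: measurable_bounded_integrable => //; first exact: probability_setT_lty.
  by exists `|ln e|; split; [rewrite num_real|move=> z kz x _ /=; exact: ltW].
Unshelve. all: by end_near. Qed.

End donsker_varadhan.

(** * Mixtures and iterated kernels *)

Section mixtures.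
Context dX dY (X : measurableType dX) (Y : measurableType dY) (R : realType).
Variables (m : probability X R) (k : R.-pker X ~> Y).

(** The mixture is the composition of [k] with the constant kernel [m] on the
    one-point space, so the formula for composed kernels applies. *)
Lemma integral_mixture (m' : {measure set Y -> \bar R}) (f : Y -> \bar R) :
  (forall A, measurable A -> m' A = \int[m]_x k x A)%E ->
  (forall y, 0 <= f y)%E -> measurable_fun setT f ->
  (\int[m']_y f y = \int[m]_x \int[k x]_y f y)%E.
Proof.
move=> m'E f0 mf.
pose l := kprobability (@measurable_cst _ _ unit _ setT (m : pprobability X R)).
transitivity (\int[kcomp l (kernel.kernel_snd k) tt]_y f y)%E.
  by apply: eq_measure_integral => A mA _; rewrite m'E.
by rewrite integral_kcomp.
Qed.

Lemma bounded_test_kernel b (f : Y -> R) : bounded_test b f ->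
  bounded_test b (fun x => \int[transition k x]_y f y).
Proof.
move=> bf; split; last by move=> x; exact: Rintegral_bounded.
apply/measurable_EFinP.
rewrite (_ : _ \o _ = fun x => (\int[k x]_y (f y)%:E)%E); last first.
  by apply/funext => x /=; rewrite (EFin_Rintegral _ bf).
apply: measurable_fun_integral_kernel => //.
- exact: measurable_kernel.
- by move=> y; rewrite lee_fin; case/andP: (bf.2 y).
- by apply/measurable_EFinP; exact: bf.1.
Qed.

Lemma Rintegral_mixture (m' : probability Y R) b (f : Y -> R) :
  (forall A, measurable A -> m' A = \int[m]_x k x A)%E ->
  bounded_test b f ->
  \int[m']_y f y = \int[m]_x \int[transition k x]_y f y.
Proof.
move=> m'E bf; apply/EFin_inj.
rewrite (EFin_Rintegral _ bf) (EFin_Rintegral _ (bounded_test_kernel bf)).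
rewrite (integral_mixture m'E).
- by apply: eq_integral => x _; rewrite (EFin_Rintegral _ bf).
- by move=> y; rewrite lee_fin; case/andP: (bf.2 y).
- by apply/measurable_EFinP; exact: bf.1.
Qed.

End mixtures.

Definition markov_op dX (X : measurableType dX) (R : realType)
    (P : R.-pker X ~> X) (f : X -> R) (x : X) : R :=
  \int[transition P x]_y f y.

Section markov_operator.
Context dX (X : measurableType dX) (R : realType) (P : R.-pker X ~> X).

Lemma bounded_test_iter_markov_op n b (f : X -> R) :
  bounded_test b f -> bounded_test b (iter n (markov_op P) f).
Proof. by move=> bf; elim: n => //= n IH; exact: bounded_test_kernel. Qed.

(** The iterated kernel is defined by adding the last step, whereas the induction
    on the number of steps needs the first step outermost; the powers of
    [markov_op] can be read both ways. *)
Lemma Rintegral_kernel_iter n b (f : X -> R) x : bounded_test b f ->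
  \int[transition (kernel_iter P n) x]_y f y = iter n (markov_op P) f x.
Proof.
elim: n f => [|n IH] f bf.
  apply/EFin_inj; rewrite (EFin_Rintegral _ bf) /=.
  rewrite (@eq_measure_integral _ _ _ _ (dirac x))//.
  rewrite integral_dirac// ?diracT ?mul1e//.
  by apply/measurable_EFinP; exact: bf.1.
rewrite iterSr -IH; last exact: bounded_test_kernel.
by apply: (Rintegral_mixture (k := P) _ bf).
Qed.

Lemma Rintegral_kernel_act (mu : probability X R) n b (f : X -> R) :
  bounded_test b f ->
  \int[kernel_act mu (kernel_iter P n)]_y f y =
  \int[mu]_x iter n (markov_op P) f x.
Proof.
move=> bf; rewrite (Rintegral_mixture (k := kernel_iter P n) (m := mu) _ bf)//.
by apply: eq_Rintegral => x _; exact: Rintegral_kernel_iter bf.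
Qed.

End markov_operator.

(** * Comparing integrals through couplings *)

Section euclidean.
Context (R : realType) (d : nat).
Implicit Types x y : 'rV[R]_d.

Lemma eucl_norm_ge0 x : 0 <= eucl_norm x.
Proof. exact: sqrtr_ge0. Qed.

Lemma eucl_normZ (c : R) x : 0 <= c -> eucl_norm (c *: x) = c * eucl_norm x.
Proof.
move=> c0; rewrite /eucl_norm.
under eq_bigr do rewrite mxE exprMn.
by rewrite -mulr_sumr sqrtrM ?sqr_ge0// sqrtr_sqr ger0_norm.
Qed.

Lemma eucl_dist_segment_start (c : R) x y : 0 <= c ->
  eucl_dist (y + c *: (x - y)) y = c * eucl_dist x y.
Proof. by move=> c0; rewrite /eucl_dist addrC addKr eucl_normZ. Qed.

Lemma eucl_dist_segment_end (c : R) x y : c <= 1 ->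
  eucl_dist x (y + c *: (x - y)) = (1 - c) * eucl_dist x y.
Proof.
move=> c1; rewrite /eucl_dist -eucl_normZ ?subr_ge0//.
by rewrite scalerBl scale1r opprD addrA.
Qed.

Lemma measurable_eucl_dist_sqr :
  measurable_fun setT
    ((fun z => eucl_dist z.1 z.2 ^+ 2) : borelR R d * borelR R d -> R).
Proof.
rewrite /eucl_dist; under eq_fun do rewrite eucl_norm_sqr.
apply: measurable_sum => i; apply: measurable_funX.
under eq_fun do rewrite !mxE.
by apply: measurable_funB; apply: measurableT_comp (measurable_coord i) _.
Qed.

End euclidean.

Section transport.
Context (R : realType) (d : nat) (al be : probability (borelR R d) R).

Lemma Rintegral_coupling_fst g b (f : borelR R d -> R) :
  coupling al be g -> bounded_test b f ->
  (\int[g]_z (f z.1)%:E = (\int[al]_x f x)%:E)%E.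
Proof.
move=> [g1 _] bf; rewrite (EFin_Rintegral _ bf).
rewrite -(@eq_measure_integral _ _ _ _ al (pushforward g fst)); last first.
  by move=> A mA _; exact: g1.
rewrite (ge0_integral_pushforward measurable_fst)//.
- by apply/measurable_EFinP; exact: bf.1.
- by move=> x _; rewrite lee_fin; case/andP: (bf.2 x).
Qed.

Lemma Rintegral_coupling_snd g b (f : borelR R d -> R) :
  coupling al be g -> bounded_test b f ->
  (\int[g]_z (f z.2)%:E = (\int[be]_x f x)%:E)%E.
Proof.
move=> [_ g2] bf; rewrite (EFin_Rintegral _ bf).
rewrite -(@eq_measure_integral _ _ _ _ be (pushforward g snd)); last first.
  by move=> A mA _; exact: g2.
rewrite (ge0_integral_pushforward measurable_snd)//.
- by apply/measurable_EFinP; exact: bf.1.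
- by move=> x _; rewrite lee_fin; case/andP: (bf.2 x).
Qed.

(** With a coupling of transport cost below [v], replacing the linear term
    [q D] by [q (D^2 / v + v) / 2] leaves only the second moment of the distance
    to integrate; this majorant is exact at [D = v], so that no constant is
    lost. *)
Lemma le_Rintegral_W2_lt b (F G : borelR R d -> R) (p q e v : R) :
  bounded_test b F -> bounded_test b G ->
  0 <= p -> 0 <= q -> 0 <= e -> 0 < v ->
  (forall x y, F x <= G y +
     (p * eucl_dist x y ^+ 2 + q * eucl_dist x y + e)) ->
  (W2 al be < v%:E)%E ->
  \int[al]_x F x <= \int[be]_x G x + (p * v ^+ 2 + q * v + e).
Proof.
move=> bF bG p0 q0 e0 v0 FG /ereal_inf_ltP[_ [g cg <-]] Wv.
set I := (\int[g]_z (eucl_dist z.1 z.2 ^+ 2)%:E)%E in Wv.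
have I0 : (0 <= I)%E by apply: integral_ge0 => z _; rewrite lee_fin sqr_ge0.
have [i i0 [Ii iv]] : exists2 i, 0 <= i & I = i%:E /\ i <= v ^+ 2.
  move: Wv I0; case: I => [i| |]//=; rewrite lte_fin lee_fin => iv i0.
  exists i => //; split=> //.
  by rewrite -(sqr_sqrtr i0) lerXn2r ?nnegrE ?sqrtr_ge0 ?ltW.
pose A := p + q / (2 * v); pose E := q * v / 2 + e.
have A0 : 0 <= A by rewrite addr_ge0// divr_ge0// mulr_ge0// ltW.
have E0 : 0 <= E by rewrite addr_ge0// divr_ge0// mulr_ge0// ltW.
have ptw x y : F x <= G y + A * eucl_dist x y ^+ 2 + E.
  apply: (le_trans (FG x y)); rewrite -[leRHS]addrA lerD2l /A /E.
  set D := eucl_dist x y.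
  have -> : (p + q / (2 * v)) * D ^+ 2 + (q * v / 2 + e) =
    p * D ^+ 2 + q * D + e + q / (2 * v) * (D - v) ^+ 2.
    by field; rewrite gt_eqF.
  by rewrite lerDl mulr_ge0 ?sqr_ge0// divr_ge0// mulr_ge0// ltW.
have mF : measurable_fun setT (fun z : borelR R d * borelR R d => (F z.1)%:E).
  by apply/measurable_EFinP; exact: measurableT_comp bF.1 _.
have mG : measurable_fun setT (fun z : borelR R d * borelR R d => (G z.2)%:E).
  by apply/measurable_EFinP; exact: measurableT_comp bG.1 _.
have mD : measurable_fun setT (fun z : borelR R d * borelR R d =>
    (eucl_dist z.1 z.2 ^+ 2)%:E).
  by apply/measurable_EFinP; exact: measurable_eucl_dist_sqr.
have mAD : measurable_fun setT (fun z : borelR R d * borelR R d =>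
    A%:E * (eucl_dist z.1 z.2 ^+ 2)%:E)%E.
  by apply: emeasurable_funM.
have F0 z : (0 <= (F z)%:E)%E by rewrite lee_fin; case/andP: (bF.2 z).
have G0 z : (0 <= (G z)%:E)%E by rewrite lee_fin; case/andP: (bG.2 z).
have D0 x y : (0 <= A%:E * (eucl_dist x y ^+ 2)%:E)%E.
  by rewrite -EFinM lee_fin mulr_ge0// sqr_ge0.
apply: (@le_trans _ _ (\int[be]_x G x + (A * i + E))).
  rewrite -lee_fin -(Rintegral_coupling_fst cg bF).
  have -> : (\int[be]_x G x + (A * i + E))%:E =
     (\int[g]_z ((G z.2)%:E + A%:E * (eucl_dist z.1 z.2 ^+ 2)%:E + E%:E))%E.
    rewrite ge0_integralD//.
    - rewrite ge0_integralD//.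
      rewrite (Rintegral_coupling_snd cg bG) ge0_integralZl_EFin//.
      + by rewrite -/I Ii integral_cst1 -EFinM -!EFinD addrA.
      + by move=> z _; rewrite lee_fin sqr_ge0.
    - by move=> z _; rewrite adde_ge0.
    - by apply: emeasurable_funD.
  apply: ge0_le_integral => //.
  - by do 2 apply: emeasurable_funD => //.
  - by move=> z _; rewrite -EFinM -!EFinD lee_fin.
rewrite lerD2l.
have Ai : A * i <= A * v ^+ 2 by rewrite ler_wpM2l.
apply: (@le_trans _ _ (A * v ^+ 2 + E)); first by rewrite lerD2r.
rewrite le_eqVlt; apply/orP; left; apply/eqP; rewrite /A /E.
by field; rewrite gt_eqF.
Qed.

(** The infimum defining [W2] may not be attained, whence a limit from strictly
    larger values. *)
Lemma le_Rintegral_W2 b (F G : borelR R d -> R) (p q e u : R) :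
  bounded_test b F -> bounded_test b G ->
  0 <= p -> 0 <= q -> 0 <= e -> 0 <= u ->
  (forall x y, F x <= G y +
     (p * eucl_dist x y ^+ 2 + q * eucl_dist x y + e)) ->
  (W2 al be <= u%:E)%E ->
  \int[al]_x F x <= \int[be]_x G x + (p * u ^+ 2 + q * u + e).
Proof.
move=> bF bG p0 q0 e0 u0 FG Wu; apply/ler_addgt0Pr => eps eps0.
(* For h <= 1, moving from u to u + h changes the quadratic bound by at most h L. *)
pose L := p * (2 * u + 1) + q + 1.
have L0 : 0 < L by rewrite ltr_wpDl// addr_ge0// mulr_ge0// addr_ge0// mulr_ge0.
pose h := Num.min 1 (eps / L).
have h0 : 0 < h by rewrite lt_min ltr01 divr_gt0.
have h1 : h <= 1 by rewrite ge_min lexx.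
have hL : h * L <= eps by rewrite -ler_pdivlMr// ge_min lexx orbT.
have uh0 : 0 < u + h by rewrite ltr_wpDl.
have := le_Rintegral_W2_lt bF bG p0 q0 e0 uh0 FG (le_lt_trans Wu _).
rewrite lte_fin ltrDl => /(_ h0) /le_trans; apply.
rewrite -[leRHS]addrA lerD2l.
have : 0 <= p * h * (1 - h) by rewrite !mulr_ge0// ?subr_ge0// ltW.
by move: hL; rewrite /L; nra.
Qed.

End transport.

(** * The dual inequality along a shift schedule *)

(** Price of the schedule [s] from distance [r], in units of [C]; the empty
    schedule is the last step, where the whole remaining distance is paid. *)
Fixpoint shift_cost (R : realType) (K M : R) (s : seq R) (r : R) : R :=
  if s is eta :: s' then (eta * r) ^+ 2 + shift_cost K M s' (K * ((1 - eta) * r) + M)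
  else r ^+ 2.

Definition shift_schedule (R : realType) (s : seq R) : bool :=
  all (fun eta => 0 <= eta <= 1) s.

(** Each new distance is an affine function of [r] with nonnegative
    coefficients, so the sum of the squared displacements is such a quadratic.
    This is the form in which costs can be averaged over a coupling. *)
Lemma shift_cost_quadratic (R : realType) (K M : R) (s : seq R) :
  0 <= K -> 0 <= M -> shift_schedule s ->
  exists p q e : R, [/\ 0 <= p, 0 <= q, 0 <= e &
    forall r, shift_cost K M s r = p * r ^+ 2 + q * r + e].
Proof.
move=> K0 M0; elim: s => [_|eta s IH /= /andP[/andP[eta0 eta1] /IH]].
  by exists 1, 0, 0; split=> // r /=; ring.
move=> [p [q [e [p0 q0 e0 spq]]]].
have k0 : 0 <= K * (1 - eta) by rewrite mulr_ge0// subr_ge0.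
exists (eta ^+ 2 + p * (K * (1 - eta)) ^+ 2),
  (2 * p * (K * (1 - eta)) * M + q * (K * (1 - eta))), (p * M ^+ 2 + q * M + e).
split=> [|||r]; rewrite ?addr_ge0 ?mulr_ge0 ?sqr_ge0 ?subr_ge0//.
by rewrite /= spq; ring.
Qed.

Section shifted_composition.
Context (R : realType) (d : nat) (P : R.-pker (borelR R d) ~> (borelR R d)).
Variables (C K M : R).
Hypotheses (C_ge0 : 0 <= C) (K_ge0 : 0 <= K) (M_ge0 : 0 <= M).
Hypothesis P_entropy : forall x y : 'rV[R]_d,
  (rel_entropy (transition P x) (transition P y)
    <= (C * eucl_dist x y ^+ 2)%:E)%E.
Hypothesis P_W2 : forall x y : 'rV[R]_d,
  (W2 (transition P x) (transition P y) <= (K * eucl_dist x y + M)%:E)%E.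

Lemma one_step_dual b (f : borelR R d -> R) x y : bounded_test b f ->
  \int[transition P x]_z f z <=
  ln (\int[transition P y]_z expR (f z)) + C * eucl_dist x y ^+ 2.
Proof.
move=> bf; have := le_trans (rel_entropy_lower _ _ bf) (P_entropy x y).
by rewrite lee_fin lerBlDl.
Qed.

Lemma le_Rintegral_shift_cost b (F G : borelR R d -> R) s
    (al be : probability (borelR R d) R) u :
  bounded_test b F -> bounded_test b G -> shift_schedule s -> 0 <= u ->
  (forall x y, F x <= G y + C * shift_cost K M s (eucl_dist x y)) ->
  (W2 al be <= u%:E)%E ->
  \int[al]_x F x <= \int[be]_x G x + C * shift_cost K M s u.
Proof.
move=> bF bG /(shift_cost_quadratic K_ge0 M_ge0)[p [q [e [p0 q0 e0 spq]]]] u0 FG Wu.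
have E r : C * shift_cost K M s r = C * p * r ^+ 2 + C * q * r + C * e.
  by rewrite spq; ring.
rewrite E; apply: le_Rintegral_W2 bF bG _ _ _ u0 _ Wu; rewrite ?mulr_ge0//.
by move=> x y; rewrite -E.
Qed.

Lemma iter_markov_op_expR_ge1 n b (f : borelR R d -> R) x : bounded_test b f ->
  1 <= iter n (markov_op P) (expR \o f) x.
Proof.
move=> bf; elim: n x => [x|n IH x] /=.
  by rewrite -[leLHS]expR0 ler_expR; case/andP: (bf.2 x).
rewrite /markov_op -[leLHS](Rintegral_cst1 (transition P x)).
apply: le_Rintegral => //.
- exact: bounded_test_integrable (bounded_test_cst _ ler01).
- apply: bounded_test_integrable.
  exact: bounded_test_iter_markov_op (bounded_test_expR bf).
Qed.

(** The function [ln (P^n e^f)] is again a bounded test function, so that it can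
    be fed into the one-step inequality. *)
Lemma bounded_test_ln_iter n b (f : borelR R d -> R) : bounded_test b f ->
  bounded_test b (fun x => ln (iter n (markov_op P) (expR \o f) x)).
Proof.
move=> bf; have bn := bounded_test_iter_markov_op P n (bounded_test_expR bf).
split; first by apply: measurableT_comp => //; exact: bn.1.
move=> x; have ge1 := iter_markov_op_expR_ge1 n x bf.
rewrite ln_ge0//= -[leRHS]expRK ler_ln ?posrE ?expR_gt0 ?(lt_le_trans ltr01)//.
by case/andP: (bn.2 x).
Qed.

(** For the step, the intermediate point [z] splits the passage from [x] to [y]:
    the part from [x] to [z] is left to the remaining schedule, through the
    Wasserstein assumption, and the part from [z] to [y] is paid for by the
    entropy assumption. *)
Lemma iter_markov_op_dual s b (f : borelR R d -> R) x y :
  shift_schedule s -> bounded_test b f ->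
  iter (size s).+1 (markov_op P) f x <=
  ln (iter (size s).+1 (markov_op P) (expR \o f) y)
    + C * shift_cost K M s (eucl_dist x y).
Proof.
move=> + bf; elim: s x y => [x y _|eta s IH x y /= /andP[/andP[eta0 eta1] sP]].
  exact: one_step_dual bf.
set n := size s in IH *; set r := eucl_dist x y.
pose z := y + eta *: (x - y).
have zy : eucl_dist z y = eta * r by exact: eucl_dist_segment_start.
have xz : eucl_dist x z = (1 - eta) * r by exact: eucl_dist_segment_end.
have bF := bounded_test_iter_markov_op P n.+1 bf.
have bG := bounded_test_ln_iter n.+1 bf.
have u0 : 0 <= K * ((1 - eta) * r) + M.
  by rewrite addr_ge0 ?mulr_ge0 ?subr_ge0 ?eucl_norm_ge0.
have Wxz : (W2 (transition P x) (transition P z) <=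
    (K * ((1 - eta) * r) + M)%:E)%E by rewrite -xz; exact: P_W2.
have := le_Rintegral_shift_cost bF bG sP u0 (fun x' y' => IH x' y' sP) Wxz.
move=> /le_trans; apply.
rewrite mulrDr addrA lerD2r.
have := one_step_dual z y bG; rewrite zy => /le_trans; apply.
rewrite lerD2r le_eqVlt; apply/orP; left; apply/eqP; congr ln.
apply: eq_Rintegral => x' _; rewrite lnK// posrE.
by rewrite (lt_le_trans ltr01)//; exact: iter_markov_op_expR_ge1 bf.
Qed.

Lemma rel_entropy_kernel_iter_le (mu nu : probability (borelR R d) R) s w :
  0 <= w -> shift_schedule s -> (W2 mu nu <= w%:E)%E ->
  (rel_entropy (kernel_act mu (kernel_iter P (size s).+1))
     (kernel_act nu (kernel_iter P (size s).+1)) <= (C * shift_cost K M s w)%:E)%E.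
Proof.
move=> w0 sP Ww; apply: rel_entropy_le_of_dual => b f bf.
have bef := bounded_test_expR bf.
rewrite (Rintegral_kernel_act P mu _ bf) (Rintegral_kernel_act P nu _ bef).
have bF := bounded_test_iter_markov_op P (size s).+1 bf.
have bG := bounded_test_ln_iter (size s).+1 bf.
have := le_Rintegral_shift_cost bF bG sP w0
  (fun x y => iter_markov_op_dual x y sP bf) Ww.
move=> /le_trans; apply; rewrite lerD2r.
apply: (le_trans (Rintegral_ln_le nu bG)).
rewrite le_eqVlt; apply/orP; left; apply/eqP; congr ln.
apply: eq_Rintegral => x _; rewrite lnK// posrE.
by rewrite (lt_le_trans ltr01)//; exact: iter_markov_op_expR_ge1 bf.
Qed.

End shifted_composition.

(** * The optimal schedule *)

Definition geom_sum (R : realType) (q : R) (m : nat) : R := \sum_(j < m) q ^+ j.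

Section optimal_schedule.
Context (R : realType) (K M : R).
Hypotheses (K_ge0 : 0 <= K) (K_le1 : K <= 1) (M_ge0 : 0 <= M).

Local Notation S := (geom_sum K).
Local Notation Q := (geom_sum (K ^+ 2)).

Lemma geom_sumS (q : R) m : geom_sum q m.+1 = geom_sum q m + q ^+ m.
Proof. by rewrite /geom_sum big_ord_recr. Qed.

Lemma geom_sum_ge0 (q : R) m : 0 <= q -> 0 <= geom_sum q m.
Proof. by move=> q0; apply: sumr_ge0 => j _; exact: exprn_ge0. Qed.

Lemma geom_sumS_ge1 (q : R) m : 0 <= q -> 1 <= geom_sum q m.+1.
Proof.
move=> q0; elim: m => [|m IH]; first by rewrite /geom_sum big_ord1.
by rewrite geom_sumS (le_trans IH)// lerDl exprn_ge0.
Qed.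

(** Starting from distance [M], the optimal displacement never overshoots. *)
Lemma geom_sum_cross m : K ^+ m * S m <= Q m.
Proof.
rewrite mulr_sumr; apply: ler_sum => j _.
rewrite -exprD -exprM ler_wiXn2l// mulSn mul1n leq_add2r.
exact: ltnW.
Qed.

(** Minimal sum of squares of displacements subject only to meeting after
    [m + 1] steps, from distance [D] (the Cauchy-Schwarz value). *)
Definition steered (m : nat) (D : R) : R := (K ^+ m * D + M * S m) ^+ 2 / Q m.+1.

(** The hypothesis says that the first displacement [a] of the Cauchy-Schwarz
    optimum is at most [D].  The next distance is then at least [M], so that
    all later displacements are admissible as well. *)
Lemma optimal_schedule m (D : R) : 0 <= D -> K ^+ m * (M * S m) <= D * Q m ->
  exists s, [/\ size s = m, shift_schedule s & shift_cost K M s D = steered m D].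
Proof.
elim: m D => [D D0 _|m IH D D0 feas].
  exists [::]; split=> //=.
  by rewrite /steered /geom_sum big_ord0 big_ord1 !expr0 mul1r mulr0 addr0 divr1.
pose T := K ^+ m.+1 * D + M * S m.+1.
have Q1 := geom_sumS_ge1 m (sqr_ge0 K).
have Q2 := geom_sumS_ge1 m.+1 (sqr_ge0 K).
have Q2gt0 : 0 < Q m.+2 by lra.
have S0 n : 0 <= S n by exact: geom_sum_ge0.
have T0 : 0 <= T by rewrite addr_ge0 ?mulr_ge0 ?exprn_ge0.
have k2E : (K ^+ 2) ^+ m.+1 = K ^+ m.+1 * K ^+ m.+1 by rewrite -exprM -exprD addnn mul2n.
pose a := K ^+ m.+1 * T / Q m.+2.
have a0 : 0 <= a by rewrite divr_ge0 ?mulr_ge0 ?exprn_ge0// ltW.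
have aD : a <= D.
  rewrite ler_pdivrMr// geom_sumS k2E /T.
  by move: feas; lra.
(* for D = 0 also a = 0, and the value 0 of the division is a valid coefficient *)
pose eta := a / D.
have etaD : eta * D = a.
  have [D0'|D0'] := eqVneq D 0; last by rewrite divfK.
  by rewrite D0' mulr0; apply/eqP; rewrite eq_le a0 -D0' aD.
have eta01 : 0 <= eta <= 1.
  have [D0'|D0'] := eqVneq D 0; first by rewrite /eta D0' invr0 mulr0 lexx ler01.
  by rewrite divr_ge0//= ler_pdivrMr ?mul1r// lt_def D0'.
pose D' := K * (D - a) + M.
have D'M : M <= D' by rewrite lerDr mulr_ge0// subr_ge0.
have D'0 : 0 <= D' by exact: le_trans D'M.
have [|s [ss sP sE]] := IH D' D'0.
  rewrite mulrCA (@le_trans _ _ (M * Q m))//.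
    by rewrite ler_wpM2l// geom_sum_cross.
  by rewrite ler_wpM2r// geom_sum_ge0 ?sqr_ge0.
exists (eta :: s); split=> /=; [by rewrite ss|by rewrite eta01|].
rewrite mulrBl mul1r etaD -/D' sE /steered -/T.
have -> : K ^+ m * D' + M * S m = T * (Q m.+1 / Q m.+2).
  have -> : Q m.+1 / Q m.+2 = 1 - K ^+ m.+1 * K ^+ m.+1 / Q m.+2.
    by rewrite (geom_sumS _ m.+1) k2E; field; rewrite -k2E -geom_sumS gt_eqF.
  rewrite /D' [RHS]mulrBr mulr1.
  have -> : T * (K ^+ m.+1 * K ^+ m.+1 / Q m.+2) = K ^+ m.+1 * a by rewrite /a; ring.
  by rewrite /T geom_sumS exprS; ring.
rewrite /a.
have -> : (K ^+ m.+1 * T / Q m.+2) ^+ 2 = (Q m.+2 - Q m.+1) * (T ^+ 2 / Q m.+2 ^+ 2).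
  by rewrite [in X in (X - _)]geom_sumS [X in X - _]addrC addrK k2E; field; rewrite gt_eqF.
by field; rewrite !gt_eqF//; lra.
Qed.

Definition steered_bound (m : nat) (w : R) : R :=
  if K ^+ m * (M * S m) <= w * Q m then steered m w
  else w ^+ 2 + (M * S m) ^+ 2 / Q m.

(** When the unconstrained optimum overshoots, closing the whole gap at once
    ([eta = 1]) resets the distance to [M], from which the optimum is feasible. *)
Lemma schedule_steered_bound m (w : R) : 0 <= w ->
  exists s, [/\ size s = m, shift_schedule s & shift_cost K M s w = steered_bound m w].
Proof.
move=> w0; rewrite /steered_bound; case: ifPn; first exact: optimal_schedule.
case: m => [|m _]; first by rewrite /geom_sum !big_ord0 !mulr0 lexx.
have [|s [ss sP sE]] := @optimal_schedule m M M_ge0.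
  by rewrite mulrCA ler_wpM2l// geom_sum_cross.
exists (1 :: s); split=> /=; [by rewrite ss|by rewrite ler01 lexx|].
rewrite subrr mul0r mulr0 add0r mul1r sE /steered; congr (_ + _ ^+ 2 / _).
by rewrite geom_sumS; ring.
Qed.

(** In the second regime [w q <= k v], where [k = K^m], [v = M * S m] and
    [q = Q m]; with [k^2 <= 1 <= q] this bounds the two unwanted terms of
    [(w^2 + v^2 / q) (q + k^2)] by [k w v] and [v^2]. *)
Lemma steered_bound_le m (w : R) : 0 <= w ->
  steered_bound m w <= 2 * steered m w.
Proof.
move=> w0; have Qm1 : 0 < Q m.+1.
  by rewrite (lt_le_trans ltr01)// geom_sumS_ge1// sqr_ge0.
have st0 : 0 <= steered m w by rewrite divr_ge0 ?sqr_ge0// ltW.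
rewrite /steered_bound; case: ifPn => [_|]; first lra.
case: m Qm1 {st0} => [|m] Qm1; first by rewrite /geom_sum !big_ord0 !mulr0 lexx.
rewrite -ltNge /steered => infeas.
have Q1 := geom_sumS_ge1 m (sqr_ge0 K).
have k2E : (K ^+ 2) ^+ m.+1 = (K ^+ m.+1) ^+ 2 by rewrite -!exprM mulnC.
rewrite mulrA ler_pdivlMr// (geom_sumS _ m.+1) k2E.
have k0 : 0 <= K ^+ m.+1 by exact: exprn_ge0.
have k1 : K ^+ m.+1 <= 1 by exact: exprn_ile1.
have v0 : 0 <= M * S m.+1 by rewrite mulr_ge0// geom_sum_ge0.
move: infeas k0 k1 v0 Q1.
set k := K ^+ m.+1; set v := M * S m.+1; set q := Q m.+1 => infeas k0 k1 v0 q1.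
have q0 : 0 < q by lra.
have -> : (w ^+ 2 + v ^+ 2 / q) * (q + k ^+ 2) =
    w * (w * q) + w ^+ 2 * k ^+ 2 + v ^+ 2 + v ^+ 2 * (k ^+ 2 / q).
  by field; rewrite gt_eqF.
have h1 : w * (w * q) <= w * (k * v) by rewrite ler_wpM2l// ltW.
have h2 : v ^+ 2 * (k ^+ 2 / q) <= v ^+ 2.
  rewrite ler_piMr ?sqr_ge0// ler_pdivrMr// mul1r (le_trans _ q1)//.
  exact: exprn_ile1.
have h3 : 0 <= w * (k * v) by rewrite mulr_ge0// mulr_ge0.
have h4 : 0 <= (k * w) ^+ 2 by exact: sqr_ge0.
have -> : 2 * (k * w + v) ^+ 2 = 2 * (k * w) ^+ 2 + 4 * (w * (k * v)) + 2 * v ^+ 2 by ring.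
have -> : w ^+ 2 * k ^+ 2 = (k * w) ^+ 2 by ring.
have := sqr_ge0 v; lra.
Qed.

End optimal_schedule.

Lemma geom_sum1 (R : realType) m : geom_sum (1 : R) m = m%:R.
Proof.
rewrite /geom_sum; under eq_bigr do rewrite expr1n.
by rewrite sumr_const card_ord.
Qed.

Lemma geom_sumE (R : realType) (q : R) m : q != 1 ->
  geom_sum q m = (1 - q ^+ m) / (1 - q).
Proof.
move=> q1; have q1' : 1 - q != 0 by rewrite subr_eq0 eq_sym.
apply: (canRL (mulfK q1')).
by rewrite -[1 - q ^+ m]opprB subrX1 -/(geom_sum q m); ring.
Qed.

Lemma steered_bound1 (R : realType) (M w : R) m :
  steered_bound 1 M m w =
  if M <= w then (w + m%:R * M) ^+ 2 / m.+1%:R else w ^+ 2 + m%:R * M ^+ 2.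
Proof.
rewrite /steered_bound /steered !expr1n !geom_sum1 !mul1r [M * _]mulrC.
case: m => [|m]; last first.
  rewrite [w * _]mulrC ler_pM2l ?ltr0n//; case: ifP => // _.
  have : m.+1%:R != 0 :> R by rewrite pnatr_eq0.
  by move: (m.+1%:R : R) => c c0; congr (_ + _); field.
by rewrite !(mulr0n, mul0r, mulr0) lexx !addr0 divr1; case: ifP.
Qed.

Lemma steeredE (R : realType) (K M w : R) m : 0 <= K -> K < 1 ->
  steered K M m w = (1 - K ^+ 2) / (1 - K ^+ (2 * m.+1)) *
    (K ^+ m * w + M * ((1 - K ^+ m) / (1 - K))) ^+ 2.
Proof.
move=> K0 K1; have K2 : K ^+ 2 < 1 by rewrite exprn_ilt1.
rewrite /steered !geom_sumE ?lt_eqF// -exprM invf_div mulrC.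
by [].
Qed.

Lemma steered_boundE (R : realType) (K M w : R) m : 0 <= K -> K < 1 -> (0 < m)%N ->
  steered_bound K M m w =
  if M * (K ^+ m * (1 + K) / (1 + K ^+ m)) <= w then steered K M m w
  else w ^+ 2 + M ^+ 2 * ((1 - K ^+ m) ^+ 2 * (1 - K ^+ 2) /
                           ((1 - K ^+ (2 * m)) * (1 - K) ^+ 2)).
Proof.
move=> K0 K1 m0; have K2 : K ^+ 2 < 1 by rewrite exprn_ilt1.
have k0 : 0 <= K ^+ m by exact: exprn_ge0.
have k1 : K ^+ m < 1 by rewrite exprn_ilt1// -lt0n.
have kE : K ^+ (2 * m) = (K ^+ m) ^+ 2 by rewrite mulnC exprM.
have k21 : (K ^+ m) ^+ 2 < 1 by rewrite exprn_ilt1.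
rewrite /steered_bound !geom_sumE ?lt_eqF// -exprM kE.
set k := K ^+ m in k0 k1 k21 *.
have n1 : 1 - K != 0 by rewrite subr_eq0 gt_eqF.
have n2 : 1 - K ^+ 2 != 0 by rewrite subr_eq0 gt_eqF.
have n3 : 1 - k ^+ 2 != 0 by rewrite subr_eq0 gt_eqF.
have n4 : 1 + k != 0 by rewrite gt_eqF//; lra.
have -> : (k * (M * ((1 - k) / (1 - K))) <= w * ((1 - k ^+ 2) / (1 - K ^+ 2))) =
          (M * (k * (1 + K) / (1 + k)) <= w).
  have q0 : 0 < (1 - k ^+ 2) / (1 - K ^+ 2) by rewrite divr_gt0 ?subr_gt0.
  rewrite -[RHS](ler_pM2r q0); congr (_ <= _).
  by field; rewrite n1 n2 n4.
by case: ifP => // _; congr (_ + _); field; rewrite n1 n2 n3.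
Qed.

(** * Entropy bound after N steps *)

Theorem theorem3p2 (R : realType) (d : nat)
  (P : R.-pker (borelR R d) ~> (borelR R d)) (C K M : R)
  (C_ge0 : 0 <= C) (K_ge0 : 0 <= K) (K_le1 : K <= 1) (M_ge0 : 0 <= M)
  (P_entropy : forall x y : 'rV[R]_d,
    (rel_entropy (transition P x) (transition P y)
     <= (C * eucl_dist x y ^+ 2)%:E)%E)
  (P_W2 : forall x y : 'rV[R]_d,
    (W2 (transition P x) (transition P y) <= (K * eucl_dist x y + M)%:E)%E)
  (mu nu : probability (borelR R d) R)
  (mu_P2 : finite_second_moment mu) (nu_P2 : finite_second_moment nu)
  (N : nat) (N_ge1 : (1 <= N)%N) :
  let H := rel_entropy (kernel_act mu (kernel_iter P N))
                       (kernel_act nu (kernel_iter P N)) in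
  let w := fine (W2 mu nu) in
  (K = 1 ->
   let B := if M <= w then (w + N.-1%:R * M) ^+ 2 / N%:R
            else w ^+ 2 + N.-1%:R * M ^+ 2 in
   (H <= (C * B)%:E)%E /\
   C * B <= 2 * C * ((w + N.-1%:R * M) ^+ 2 / N%:R)) /\
  (K < 1 -> (2 <= N)%N ->
   let A := (1 - K ^+ 2) / (1 - K ^+ (2 * N)) *
            (K ^+ N.-1 * w + M * ((1 - K ^+ N.-1) / (1 - K))) ^+ 2 in
   let B := if M * (K ^+ N.-1 * (1 + K) / (1 + K ^+ N.-1)) <= w then A
            else w ^+ 2 +
                 M ^+ 2 * ((1 - K ^+ N.-1) ^+ 2 * (1 - K ^+ 2) /
                           ((1 - K ^+ (2 * N - 2)) * (1 - K) ^+ 2)) in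
   (H <= (C * B)%:E)%E /\ C * B <= 2 * C * A).
Proof.
move=> H w; case: N N_ge1 @H => // m _ H.
have W0 : (0 <= W2 mu nu)%E.
  by apply/ereal_infP => _ [g _ <-]; exact: sqrte_ge0.
have w0 : 0 <= w by exact: fine_ge0.
have Ww : (W2 mu nu <= w%:E)%E by rewrite fineK// W2_fin_num.
have bound : (H <= (C * steered_bound K M m w)%:E)%E /\
    C * steered_bound K M m w <= 2 * C * steered K M m w.
  split; last by rewrite -mulrA mulrCA ler_wpM2l// steered_bound_le.
  have [s [ss sP <-]] := schedule_steered_bound K_ge0 K_le1 M_ge0 m w0.
  rewrite /H -ss.
  exact: rel_entropy_kernel_iter_le.
split=> [K1|K1 m1] /=.
  move: bound; rewrite K1 steered_bound1.
  by rewrite /steered !expr1n !geom_sum1 !mul1r [M * _]mulrC.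
move: bound; rewrite steered_boundE// steeredE// => bound.
have -> : (2 * m.+1 - 2 = 2 * m)%N by rewrite mulnS addKn.
exact: bound.
Qed.
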